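(* Let $G$ be a finite group, let $I$ and $\Lambda$ be finite (non-empty) index sets, and let $P=(p_{\lambda i})$ be a regular $\Lambda\times I$ matrix with entries in $G^0$ that contains at least one zero entry. Let $Q=P[\Lambda_Q|I_Q]$ be a $0$-closure submatrix of $P$ and let $\mathcal{C}$ be the connected component of $\mathcal{G}(\mathcal{M}_0[G;I,\Lambda;P])$ determined by $Q$. If $|I_Q|>1$ or $|\Lambda_Q|>1$ or $G$ is trivial, then $$\mathrm{diam}(\mathcal{C})=\max\{\zeta(\lambda,i): i\in I_Q,\ \lambda\in\Lambda_Q\text{ and }p_{\lambda i}=0\}.$$
   Context: $G^0=G\cup\{0\}$ is $G$ with a zero adjoined. A matrix over $G^0$ is regular if every row and every column contains a non-zero entry. The $0$-Rees matrix semigroup $\mathcal{M}_0[G;I,\Lambda;P]$ is the set $(I\times G\times\Lambda)\cup\{0\}$ with $(i,x,\lambda)(j,y,\mu)=(i,xp_{\lambda j}y,\mu)$ if $p_{\lambda j}\neq 0$, $(i,x,\lambda)(j,y,\mu)=0$ if $p_{\lambda j}=0$, and all products involving $0$ equal to $0$. The commuting graph $\mathcal{G}(S)$ of a finite non-commutative semigroup $S$ is the simple graph with vertex set $S\setminus Z(S)$ ($Z(S)$ the center), where distinct $x,y$ are adjacent iff $xy=yx$. (When $P$ is regular and has a zero entry, $\mathcal{M}_0[G;I,\Lambda;P]$ is non-commutative with center $\{0\}$.) $\mathrm{diam}$ is the maximum distance between two vertices. For $I'\subseteq I$, $\Lambda'\subseteq\Lambda$, $P[\Lambda'|I']$ is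 the submatrix of $P$ with rows indexed by $\Lambda'$ and columns by $I'$. $0$-closure method: let $p_{\lambda i}=0$. Put $I_0=\{i\}$, $\Lambda_0=\{\lambda\}$ and, for $k\ge 0$, $I_{k+1}=I_k\cup\{j\in I: p_{\mu j}=0\text{ for some }\mu\in\Lambda_k\}$ and $\Lambda_{k+1}=\Lambda_k\cup\{\mu\in\Lambda: p_{\mu j}=0\text{ for some }j\in I_k\}$. Let $\zeta(\lambda,i)$ be the least $k$ with $I_{k+1}=I_k$ and $\Lambda_{k+1}=\Lambda_k$. The $0$-closure $(\lambda,i)$-submatrix of $P$ is $P[\Lambda_k|I_k]$ with $k=\zeta(\lambda,i)$. A $0$-closure submatrix of $P$ is a $0$-closure $(\lambda,i)$-submatrix for some $(\lambda,i)$ with $p_{\lambda i}=0$. If $Q=P[\Lambda_Q|I_Q]$ is a $0$-closure submatrix of $P$, the subgraph of $\mathcal{G}(\mathcal{M}_0[G;I,\Lambda;P])$ induced by $I_Q\times G\times\Lambda_Q$ is a connected component, called the connected component determined by $Q$ (this includes the case where the whole graph is connected and $Q=P$). *)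

(* Defs.v *)
From mathcomp Require Import all_boot all_fingroup.

Set Implicit Arguments.
Unset Strict Implicit.
Unset Printing Implicit Defensive.

Local Open Scope group_scope.

(* A record rather than an HB join of Semigroup and Finite: HB rejects that join
   below the existing FinStarMonoid. *)
Record finSemigroup := FinSemigroup {
  fsg_sort :> finType;
  fsg_mul : fsg_sort -> fsg_sort -> fsg_sort;
  fsg_mulA : associative fsg_mul
}.

Definition semigroup_center (S : finSemigroup) : {set S} :=
  [set x | [forall y, fsg_mul x y == fsg_mul y x]].

Definition noncentral (S : finSemigroup) : finType :=
  {x : S | x \notin semigroup_center S}.

Definition commuting_graph (S : finSemigroup) : rel (noncentral S) :=
  [rel x y | (x != y) && (fsg_mul (val x) (val y) == fsg_mul (val y) (val x))].

Arguments commuting_graph : clear implicits.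

Definition induced (V : finType) (e : rel V) (A : {set V}) : rel {x | x \in A} :=
  relpre val e.

Arguments induced [V] e A.

Definition is_dist (V : finType) (e : rel V) (x y : V) (n : nat) : Prop :=
  (exists p : seq V, [/\ path e x p, last x p = y & size p = n]) /\
  (forall p : seq V, path e x p -> last x p = y -> n <= size p).

(* "diam e = d": all distances are finite and d is their maximum; no natural
   number is the diameter of a disconnected or empty graph. *)
Definition is_diam (V : finType) (e : rel V) (d : nat) : Prop :=
  (forall x y, exists2 n, is_dist e x y n & n <= d) /\
  (exists x y, is_dist e x y d).

(* G^0 is [option G], with [None] as its zero; a (Lambda x I)-matrix over G^0
   is a function [L -> I -> option G]. *)
Definition regular_mx (G : finGroupType) (I L : finType)
    (P : L -> I -> option G) : Prop :=
  (forall l, exists i, P l i <> None) /\ (forall i, exists l, P l i <> None).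

Section Rees.
Variables (G : finGroupType) (I L : finType) (P : L -> I -> option G).

Definition rees0_mul (s t : option (I * G * L)) : option (I * G * L) :=
  match s, t with
  | Some (i, x, l), Some (j, y, m) =>
      if P l j is Some p then Some (i, x * p * y, m) else None
  | _, _ => None
  end.

Lemma rees0_mulA : associative rees0_mul.
Proof.
move=> [[[i x] l]|] [[[j y] m]|] [[[k z] n]|] //=; last by case: (P l j).
by case Pmk: (P m k) => [q|]; case Plj: (P l j) => [p|] //=;
  rewrite ?Pmk ?Plj // !mulgA.
Qed.

Definition rees0 : finSemigroup := FinSemigroup rees0_mulA.

Definition rees0_block (IQ : {set I}) (LQ : {set L}) :
    {set noncentral rees0} :=
  [set v | if val v is Some (i, _, l)
           then (i \in IQ) && (l \in LQ) else false].

(* (I_k, Lambda_k) for the 0-closure method started at (l, i). *)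
Fixpoint zero_closure (l : L) (i : I) (k : nat) : {set I} * {set L} :=
  if k is k'.+1 then
    let: (Ik, Lk) := zero_closure l i k' in
    (Ik :|: [set j | [exists m in Lk, P m j == None]],
     Lk :|: [set m | [exists j in Ik, P m j == None]])
  else ([set i], [set l]).

Lemma zero_closure_stable l i :
  exists k, zero_closure l i k.+1 == zero_closure l i k.
Proof.
pose c k := #|(zero_closure l i k).1| + #|(zero_closure l i k).2|.
pose N := (#|I| + #|L|).+1.
case: (boolP [exists k : 'I_N, zero_closure l i k.+1 == zero_closure l i k]).
  by case/existsP=> k; exists k.
move/existsPn=> neq.
have c_ge k : k <= N -> k <= c k.
  elim: k => // k IHk ltkN; apply: (leq_ltn_trans (IHk (ltnW ltkN))).
  have := neq (Ordinal ltkN); rewrite /= /c /=.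
  case: (zero_closure l i k) => A B /=.
  set A' := A :|: _; set B' := B :|: _; rewrite xpair_eqE.
  have [sA sB] : A \subset A' /\ B \subset B' by split; apply: subsetUl.
  rewrite (eq_sym A') (eq_sym B') !eqEcard sA sB /= negb_and -!ltnNge.
  have [leA leB] := (subset_leq_card sA, subset_leq_card sB).
  by case/orP=> lt; [rewrite -addSn leq_add | rewrite -addnS leq_add].
have := c_ge N (leqnn N); rewrite /N leqNgt ltnS => /negP[].
by rewrite leq_add ?max_card.
Qed.

Definition zeta (l : L) (i : I) : nat := ex_minn (zero_closure_stable l i).

(* Submatrices P[LQ|IQ] are represented by their index sets. *)
Definition zero_closure_submx (LQ : {set L}) (IQ : {set I}) : Prop :=
  exists l i, P l i = None /\ zero_closure l i (zeta l i) = (IQ, LQ).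

(* When P[LQ|IQ] is a 0-closure submatrix, this induced subgraph is a connected
   component of the commuting graph, the one determined by P[LQ|IQ]. *)
Definition component_of (LQ : {set L}) (IQ : {set I}) :
    rel {v | v \in rees0_block IQ LQ} :=
  induced (commuting_graph rees0) (rees0_block IQ LQ).

End Rees.

Arguments component_of [G I L] P LQ IQ.

(* Main.v *)
Require Import Defs.
From mathcomp Require Import all_boot all_fingroup.

(** Let B be the bipartite graph on the disjoint union of I and Lambda whose
    edges are the zero entries of P.  The sets I_k and Lambda_k form the ball of
    radius k around the edge {i, lambda} of B, so zeta(lambda, i) is the
    eccentricity of that edge.  Elements (i, x, lambda) and (j, y, mu) with
    (i, lambda) <> (j, mu) commute iff i - mu and lambda - j are edges of B, so a
    walk in the commuting graph is a pair of simultaneous walks in B.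

    Let R be the largest eccentricity of an edge of the component.  Any u is on
    an edge {u, u'}, and any v is within R of u or u'; hence when the parity of
    R is the one that bipartiteness imposes on walks from u to v, there is a
    walk from u to v of length exactly R (prepend u, or go back and forth along
    {u, u'}).  Pairing two of them joins any two elements in R steps; if R = 0,
    the component of B is a single edge, and this is where G must be trivial.
    Conversely, k steps from (i, x, lambda) stay in the ball of radius k around
    the edge {i, lambda}, and some vertex is at distance R from an edge of
    eccentricity R. *)

Set Implicit Arguments.
Unset Strict Implicit.
Unset Printing Implicit Defensive.

(** * Walks and distances in an arbitrary graph *)

Definition walk_le (V : eqType) (e : rel V) (n : nat) (x y : V) : Prop :=
  exists p, [/\ path e x p, last x p = y & size p <= n].

Lemma walk_le_refl (V : eqType) (e : rel V) n x : walk_le e n x x.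
Proof. by exists [::]. Qed.

(** The commuting graph has no loops, so a step that stays at the same element is dropped; this is
    why [walk_le] only bounds the length. *)
Lemma walk_le_step (V : eqType) (e : rel V) n x y z :
  (x != y -> e x y) -> walk_le e n y z -> walk_le e n.+1 x z.
Proof.
case: eqVneq => [->|_] exy [p [ep lp sp]]; first by exists p; split=> //; apply: leqW.
by exists (y :: p); split=> //=; rewrite exy.
Qed.

Lemma walk_le_dist (V : finType) (e : rel V) n x y :
  walk_le e n x y -> exists2 d, is_dist e x y d & d <= n.
Proof.
case=> p [ep lp sp].
(* Quantifying over tuples makes [D] boolean, so that a least length can be extracted. *)
pose D k := [exists q : k.-tuple V, path e x q && (last x q == y)].
have DP q : path e x q -> last x q = y -> D (size q).
  by move=> eq lq; apply/existsP; exists (in_tuple q); rewrite eq /= lq eqxx.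
have exD : exists k, D k by exists (size p); apply: DP.
case: (ex_minnP exD) => d /existsP[q /andP[eq /eqP lq]] d_min.
exists d; last exact: leq_trans (d_min _ (DP p ep lp)) sp.
split; first by exists q; rewrite size_tuple.
by move=> r er lr; apply: d_min; apply: DP.
Qed.

(** * The bipartite graph B of zero entries and its balls *)

Section ZeroGraph.
Variables (G : finGroupType) (I L : finType) (P : L -> I -> option G).
Implicit Types (i j : I) (l m : L) (u v w : I + L).

Definition zadj : rel (I + L) := fun u v =>
  match u, v with
  | inl i, inr l | inr l, inl i => P l i == None
  | _, _ => false
  end.

Definition is_row u : bool := if u is inr _ then true else false.

Definition in_index (K : {set I} * {set L}) u : bool :=
  match u with inl i => i \in K.1 | inr l => l \in K.2 end.

Fixpoint zwalk n u v : Prop :=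
  if n is n'.+1 then exists2 w, zadj u w & zwalk n' w v else u = v.

Lemma zadj_sym : symmetric zadj.
Proof. by case=> [i|l] [j|m]. Qed.

Lemma zwalk_rcons n u v w : zwalk n u v -> zadj v w -> zwalk n.+1 u w.
Proof.
elim: n u => [|n IHn] u /= => [->|[t ut tv]] vw; first by exists w.
by exists t => //; apply: IHn.
Qed.

Lemma is_row_zwalk n u v : zwalk n u v -> is_row v = is_row u (+) odd n.
Proof.
elim: n u => [|n IHn] u /= => [->|[w uw /IHn ->]]; first by rewrite addbF.
by case: u w uw => [i|l] [j|m] //=; case: (odd n).
Qed.

(** The excess [k - n] is even and is spent going back and forth along the edge {u, w} before the
    given walk starts. *)
Lemma zwalk_pad n k u v w :
  zadj u w -> zwalk n u v -> n <= k -> odd n = odd k -> zwalk k u v.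
Proof.
move=> uw nuv /subnKC <-; rewrite oddD -[odd n in LHS]addbF => /addbI/esym.
move=> even_d; rewrite -(odd_double_half (k - n)) even_d add0n addnC.
elim: _./2 => //= d IHd.
by exists w => //; exists u; rewrite // zadj_sym.
Qed.

Lemma in_zero_closureS l i k u :
  in_index (zero_closure P l i k.+1) u =
  in_index (zero_closure P l i k) u
  || [exists w, in_index (zero_closure P l i k) w && zadj w u].
Proof.
case: u => [j|m] /=; case: (zero_closure P l i k) => A B /=; rewrite !inE;
  congr (_ || _); apply/existsP/existsP.
- by case=> m mB; exists (inr m).
- by case=> -[j'|m]; [rewrite andbF | exists m].
- by case=> j jA; exists (inl j).
- by case=> -[j|m']; [exists j | rewrite andbF].
Qed.

Lemma zero_closure_zwalk l i k u : in_index (zero_closure P l i k) u ->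
  exists2 n, n <= k & zwalk n (inl i) u \/ zwalk n (inr l) u.
Proof.
elim: k u => [|k IHk] u.
  by case: u => [j|m] /set1P ->; exists 0 => //; [left | right].
rewrite in_zero_closureS => /orP[/IHk[n lenk nu]|].
  by exists n => //; apply: leqW.
case/existsP=> w /andP[/IHk[n lenk nw] wu]; exists n.+1 => //.
by case: nw => nw; [left | right]; apply: zwalk_rcons wu.
Qed.

(** Applied with [f] the membership test of a set closed under adjacency, this compares closures
    started at different edges. *)
Lemma zero_closure_invariant (T : Type) (f : I + L -> T) l i k u :
    (forall v w, zadj v w -> f v = f w) -> P l i = None ->
  in_index (zero_closure P l i k) u -> f u = f (inl i).
Proof.
move=> fP Pli /zero_closure_zwalk[n _].
have fw v : zwalk n v u -> f u = f v.
  by elim: n v => [|n IHn] v /= => [->|[w /fP -> /IHn]].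
by case=> /fw // ->; apply: fP; rewrite /= Pli.
Qed.

Lemma zero_closure_zadj l i k u : P l i = None ->
  in_index (zero_closure P l i k) u -> exists w, zadj u w.
Proof.
move=> Pli; elim: k u => [|k IHk] u.
  by case: u => [j|m] /set1P ->; [exists (inr l) | exists (inl i)]; rewrite /= Pli.
rewrite in_zero_closureS => /orP[/IHk //|/existsP[w /andP[_ wu]]].
by exists w; rewrite zadj_sym.
Qed.

Lemma zero_closure_zeta_closed l i u v : zadj u v ->
  in_index (zero_closure P l i (zeta P l i)) u =
  in_index (zero_closure P l i (zeta P l i)) v.
Proof.
rewrite /zeta; case: ex_minnP => k /eqP kS _.
have cl w t : zadj w t -> in_index (zero_closure P l i k) w ->
    in_index (zero_closure P l i k) t.
  move=> wt wk; rewrite -kS in_zero_closureS; apply/orP; right.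
  by apply/existsP; exists w; rewrite wk.
by move=> uv; apply/idP/idP; apply: cl; rewrite // zadj_sym.
Qed.

Lemma base_in_zero_closure l i k :
  in_index (zero_closure P l i k) (inl i) /\
  in_index (zero_closure P l i k) (inr l).
Proof.
elim: k => [|k [IHi IHl]]; first by rewrite /= !inE !eqxx.
by rewrite !in_zero_closureS IHi IHl.
Qed.

(** Since [zeta] is minimal, stage [k] is not yet stable; the stages increase, so some vertex of B
    enters at stage [k.+1]. *)
Lemma zeta_witness l i k : zeta P l i = k.+1 ->
  exists2 u, in_index (zero_closure P l i k.+1) u
           & ~~ in_index (zero_closure P l i k) u.
Proof.
rewrite /zeta; case: ex_minnP => n _ n_min n_eq; subst n.
suff /existsP[u /andP[uS uk]] : [exists u,
    in_index (zero_closure P l i k.+1) u && ~~ in_index (zero_closure P l i k) u].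
  by exists u.
apply: contraT => /existsPn sub.
suff /eqP/n_min : zero_closure P l i k.+1 = zero_closure P l i k.
  by rewrite ltnn.
have eqK u : in_index (zero_closure P l i k.+1) u = in_index (zero_closure P l i k) u.
  have := sub u; rewrite in_zero_closureS.
  by case: (in_index _ u) => //=; rewrite andbT => /negbTE.
rewrite [LHS]surjective_pairing [RHS]surjective_pairing; congr pair.
  by apply/setP=> j; apply: (eqK (inl j)).
by apply/setP=> m; apply: (eqK (inr m)).
Qed.

(** * Commuting elements of the Rees matrix semigroup *)

Lemma rees0_mul_comm i x l j y m : P l j = None -> P m i = None ->
  rees0_mul P (Some (i, x, l)) (Some (j, y, m)) =
  rees0_mul P (Some (j, y, m)) (Some (i, x, l)).
Proof. by move=> /= -> ->. Qed.

(** Either both products are zero, or neither is and their outer indices agree. *)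
Lemma rees0_mul_commP i x l j y m :
  rees0_mul P (Some (i, x, l)) (Some (j, y, m)) =
  rees0_mul P (Some (j, y, m)) (Some (i, x, l)) ->
  (P l j = None /\ P m i = None) \/ (i = j /\ l = m).
Proof.
move=> /=; case: (P l j) (P m i) => [p|] [q|] // E; last by left.
by case: E => -> _ ->; right.
Qed.

Lemma rees0_center_nonzero i x l :
    regular_mx P -> (exists l i, P l i = None) ->
  Some (i, x, l) \notin semigroup_center (rees0 P).
Proof.
move=> [Prow Pcol] [l0 [i0 Pl0i0]]; rewrite inE; apply/negP => /forallP cen.
have {}cen j m : (P l j = None /\ P m i = None) \/ (i = j /\ l = m).
  by apply: rees0_mul_commP; apply/eqP; apply: (cen (Some (j, 1%g, m))).
have [[j Plj] [m Pmi]] := (Prow l, Pcol i).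
(* The non-zero entries [P l j] and [P m i] exclude zero products, so the indices agree and [P l j]
   is the zero entry [P l0 i0]. *)
have [[//]|[ij ll0]] := cen j l0; have [[//]|[ii0 _]] := cen i0 m.
by apply: Plj; rewrite -ij ll0 ii0.
Qed.

End ZeroGraph.

(** * The component determined by Q and its diameter *)

Section Component.
Variables (G : finGroupType) (I L : finType) (P : L -> I -> option G).
Hypotheses (P_regular : regular_mx P) (P_zero : exists l i, P l i = None).
Variables (LQ : {set L}) (IQ : {set I}).
Hypothesis Q_closure : zero_closure_submx P LQ IQ.

Local Notation vertex := {v | v \in rees0_block P IQ LQ}.
Local Notation inQ := (in_index (IQ, LQ)).
Implicit Types (i j : I) (l m : L) (u v w : I + L).

Definition max_zeta : nat :=
  \max_(i in IQ) \max_(l in LQ | P l i == None) zeta P l i.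

Lemma submx_closed u v : zadj P u v -> inQ u = inQ v.
Proof. by have [l [i [_ <-]]] := Q_closure; apply: zero_closure_zeta_closed. Qed.

Lemma submx_zadj u : inQ u -> exists w, zadj P u w.
Proof. by have [l [i [Pli <-]]] := Q_closure; apply: zero_closure_zadj. Qed.

Lemma submx_zero_entry : exists l i, [/\ P l i = None, inQ (inl i) & inQ (inr l)].
Proof.
have [l [i [Pli <-]]] := Q_closure; exists l, i.
by have [] := base_in_zero_closure P l i (zeta P l i).
Qed.

Lemma zero_closure_sub_submx l i k u : P l i = None -> inQ (inl i) ->
  in_index (zero_closure P l i k) u -> inQ u.
Proof. by move=> Pli Qi /(zero_closure_invariant submx_closed Pli) ->. Qed.

Lemma submx_sub_zero_closure l i u : P l i = None -> inQ (inl i) -> inQ u ->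
  in_index (zero_closure P l i (zeta P l i)) u.
Proof.
move=> Pli; have [l0 [i0 [Pl0i0 <-]]] := Q_closure.
set f := in_index (zero_closure P l i (zeta P l i)).
have fP v w : zadj P v w -> f v = f w by apply: zero_closure_zeta_closed.
move=> /(zero_closure_invariant fP Pl0i0) fi /(zero_closure_invariant fP Pl0i0) ->.
by rewrite -fi /f; have [] := base_in_zero_closure P l i (zeta P l i).
Qed.

Lemma zeta_le_max l i : P l i = None -> inQ (inl i) -> zeta P l i <= max_zeta.
Proof.
move=> Pli Qi; have Ql : inQ (inr l) by rewrite -(@submx_closed (inl i)) //= Pli.
by apply: (bigmax_sup i) => //; apply: (bigmax_sup l) => //; rewrite Pli eqxx andbT.
Qed.

Lemma max_zeta_attained : exists l i,
  [/\ P l i = None, inQ (inl i), inQ (inr l) & zeta P l i = max_zeta].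
Proof.
have [l0 [i0 [Pl0i0 Qi0 Ql0]]] := submx_zero_entry.
(* The alternative [n = 0] covers a [\max] over an empty range; if the maximum is 0, every zero
   entry of Q attains it. *)
pose attained n := n = 0 \/ exists l i,
  [/\ P l i = None, inQ (inl i), inQ (inr l) & zeta P l i = n].
have [R0|//] : attained max_zeta.
  have max_att (m n : nat) : attained m -> attained n -> attained (maxn m n).
    by rewrite /maxn; case: ifP.
  apply: (big_ind attained) => [||i Qi]; [by left | exact: max_att |].
  apply: (big_ind attained) => [||l /andP[Ql /eqP Pli]]; [by left | exact: max_att |].
  by right; exists l, i.
exists l0, i0; split=> //; apply/eqP.
by rewrite R0 -leqn0 -R0 zeta_le_max.
Qed.

Lemma submx_zwalk u v : inQ u -> inQ v ->
  is_row v = is_row u (+) odd max_zeta -> zwalk P max_zeta u v.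
Proof.
move=> Qu Qv side; have [u' uu'] := submx_zadj Qu.
have Qu' : inQ u' by rewrite -(submx_closed uu').
have [n leR nv] : exists2 n, n <= max_zeta & zwalk P n u v \/ zwalk P n u' v.
  case: u u' uu' Qu Qu' {side} => [i|l] [j|m] //= /eqP Pz Qu Qu'.
    have [n len nv] := zero_closure_zwalk (submx_sub_zero_closure Pz Qu Qv).
    by exists n => //; apply: leq_trans len (zeta_le_max Pz Qu).
  have [n len nv] := zero_closure_zwalk (submx_sub_zero_closure Pz Qu' Qv).
  by exists n; [apply: leq_trans len (zeta_le_max Pz Qu') | case: nv; auto].
case: nv => nv.
  apply: (zwalk_pad uu' nv leR); apply: (@addbI (is_row u)).
  by rewrite -side (is_row_zwalk nv).
have nuv : zwalk P n.+1 u v by exists u'.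
have parity : odd n.+1 = odd max_zeta.
  by apply: (@addbI (is_row u)); rewrite -side (is_row_zwalk nuv).
(* Prepending [u] could give length R + 1, but [n] = R is excluded because [n.+1] and R have the
   same parity. *)
apply: (zwalk_pad uu' nuv _ parity); rewrite ltn_neqAle leR andbT.
by apply: contra_eq_neq parity => -> /=; case: odd.
Qed.

Lemma vertex_exists i x l : inQ (inl i) -> inQ (inr l) ->
  exists a : vertex, val (val a) = Some (i, x, l).
Proof.
move=> Qi Ql.
pose s : noncentral (rees0 P) :=
  exist _ (Some (i, x, l)) (rees0_center_nonzero i x l P_regular P_zero).
have sQ : s \in rees0_block P IQ LQ by rewrite inE /=; apply/andP.
by exists (exist _ s sQ).
Qed.

Lemma vertexP (a : vertex) : exists i x l,
  [/\ val (val a) = Some (i, x, l), inQ (inl i) & inQ (inr l)].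
Proof.
have := valP a; rewrite inE; case: (val (val a)) => [[[i x] l]|] // /andP[Qi Ql].
by exists i, x, l.
Qed.

Lemma component_ofE (a b : vertex) : component_of P LQ IQ a b =
  (a != b) && (rees0_mul P (val (val a)) (val (val b)) ==
               rees0_mul P (val (val b)) (val (val a))).
Proof. by []. Qed.

(* Each step swaps I and Lambda, so the length n.+1 is even in the first case
   and odd in the second. *)
Lemma walk_le_of_zwalks n i x l j y m (a b : vertex) :
    val (val a) = Some (i, x, l) -> val (val b) = Some (j, y, m) ->
    (zwalk P n.+1 (inl i) (inl j) /\ zwalk P n.+1 (inr l) (inr m)) \/
    (zwalk P n.+1 (inl i) (inr m) /\ zwalk P n.+1 (inr l) (inl j)) ->
  walk_le (component_of P LQ IQ) n.+1 a b.
Proof.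
elim: n i x l a => [|n IHn] i x l a va vb.
  case=> [] [[u1 iu1 u1v] [u2 lu2 u2v]]; rewrite /= in u1v u2v; subst u1 u2 => //.
  apply: walk_le_step (walk_le_refl _ _ _) => neq; rewrite component_ofE neq va vb.
  by apply/eqP; apply: rees0_mul_comm; apply/eqP.
have [i' [x' [l' [va' Qi Ql]]]] := vertexP a.
move: va'; rewrite va => -[ii' _ ll']; subst i' l' => {x'} walks.
have [m' [j' [im' lj' walks']]] : exists m' j', [/\ zadj P (inl i) (inr m'),
    zadj P (inr l) (inl j') &
    (zwalk P n.+1 (inl j') (inl j) /\ zwalk P n.+1 (inr m') (inr m)) \/
    (zwalk P n.+1 (inl j') (inr m) /\ zwalk P n.+1 (inr m') (inl j))].
  by case: walks => -[[[?|m'] im' w1] [[j'|?] lj' w2]] //; exists m', j'; split; auto.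
(* The group coordinate is arbitrary: both products with a neighbour are zero. *)
have [c vc] : exists c : vertex, val (val c) = Some (j', 1%g, m').
  by apply: vertex_exists; [rewrite -(submx_closed lj') | rewrite -(submx_closed im')].
apply: walk_le_step (IHn _ _ _ _ vc vb walks') => neq.
rewrite component_ofE neq va vc.
by apply/eqP; apply: rees0_mul_comm; apply/eqP.
Qed.

Lemma component_walk_le (a b : vertex) :
    1 < #|IQ| \/ 1 < #|LQ| \/ [set: G] = 1%g ->
  walk_le (component_of P LQ IQ) max_zeta a b.
Proof.
move=> Q_cond.
have [i [x [l [va Qi Ql]]]] := vertexP a; have [j [y [m [vb Qj Qm]]]] := vertexP b.
have W := submx_zwalk; move: W; case: max_zeta => [|n] W; last first.
  apply: walk_le_of_zwalks va vb _.
  by case En: (odd n); [left | right]; split; apply: W; rewrite //= En.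
(* Now R = 0, and walks of length 0 identify all vertices of Q on the same side. *)
have IQ1 : #|IQ| <= 1.
  by apply/card_le1_eqP=> k k' Qk Qk'; have [] := W (inl k) (inl k') Qk Qk' erefl.
have LQ1 : #|LQ| <= 1.
  by apply/card_le1_eqP=> k k' Qk Qk'; have [] := W (inr k) (inr k') Qk Qk' erefl.
case: Q_cond => [|[|G1]]; [by rewrite ltnNge IQ1 | by rewrite ltnNge LQ1 |].
have g1 g : g = 1%g :> G by apply/set1P; rewrite -[[set _]]G1 inE.
suff -> : a = b by apply: walk_le_refl.
apply/val_inj/val_inj; rewrite va vb (g1 x) (g1 y).
by have [->] := W _ _ Qi Qj erefl; have [->] := W _ _ Ql Qm erefl.
Qed.

(** Commuting elements have equal indices or crosswise adjacent ones, so each step enlarges the ball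
    by at most one. The starting radius [k] is general for the induction. *)
Lemma component_walk_zero_closure l0 i0 k (a b : vertex) p i x l j y m :
    val (val a) = Some (i, x, l) -> val (val b) = Some (j, y, m) ->
    in_index (zero_closure P l0 i0 k) (inl i) ->
    in_index (zero_closure P l0 i0 k) (inr l) ->
    path (component_of P LQ IQ) a p -> last a p = b ->
  in_index (zero_closure P l0 i0 (k + size p)) (inl j) /\
  in_index (zero_closure P l0 i0 (k + size p)) (inr m).
Proof.
move=> + vb; elim: p k a i x l => [|c p IHp] k a i x l va ball_i ball_l.
  by move=> _ /= ab; move: vb; rewrite -ab va addn0 => -[<- _ <-].
rewrite [path _ _ _]/= component_ofE => /andP[/andP[_ /eqP ac] cp] lb.
have [i' [x' [l' [vc _ _]]]] := vertexP c; rewrite va vc in ac.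
rewrite [size _]/= addnS -addSn; apply: IHp vc _ _ cp lb; rewrite in_zero_closureS;
  case: (rees0_mul_commP ac) => [[z1 z2]|[ii' ll']]; rewrite -?ii' -?ll' ?ball_i ?ball_l //;
  apply/orP; right; apply/existsP.
- by exists (inr l); rewrite ball_l /= z1.
- by exists (inl i); rewrite ball_i /= z2.
Qed.

Lemma component_far_pair : exists a b : vertex, forall p,
  path (component_of P LQ IQ) a p -> last a p = b -> max_zeta <= size p.
Proof.
have [l [i [Pli Qi Ql zR]]] := max_zeta_attained.
have [a va] := vertex_exists 1%g Qi Ql.
case ER: max_zeta zR => [|k] zR; first by exists a, a.
have [u uS uk] := zeta_witness zR.
have Qu := zero_closure_sub_submx Pli Qi uS.
(* The far vertex [u] supplies one index of the target element, the base edge the other. *)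
have [j [m [Qj Qm jmu]]] : exists j m, [/\ inQ (inl j), inQ (inr m) &
    ~~ (in_index (zero_closure P l i k) (inl j) &&
        in_index (zero_closure P l i k) (inr m))].
  by case: u uk Qu {uS} => [j|m] uk Qu; [exists j, l | exists i, m];
    split=> //; apply: contra uk => /andP[].
have [b vb] := vertex_exists 1%g Qj Qm; exists a, b => p ap lp.
have mono d n u' : in_index (zero_closure P l i n) u' ->
    in_index (zero_closure P l i (n + d)) u'.
  by elim: d => [|d IHd] Hu; rewrite ?addn0 // addnS in_zero_closureS IHd.
(* A path of length at most [k] would end with both indices in the ball of radius [k]. *)
rewrite ltnNge; apply: contra jmu => /subnKC <-.
have [ball_i ball_l] := base_in_zero_closure P l i 0.
have [Hj Hm] := component_walk_zero_closure va vb ball_i ball_l ap lp.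
by rewrite !mono.
Qed.

End Component.

Theorem theorem4p20 (G : finGroupType) (I L : finType)
    (I_nonempty : 0 < #|I|) (L_nonempty : 0 < #|L|)
    (P : L -> I -> option G)
    (P_regular : regular_mx P)
    (P_zero : exists l i, P l i = None)
    (LQ : {set L}) (IQ : {set I})
    (Q_closure : zero_closure_submx P LQ IQ)
    (Q_cond : 1 < #|IQ| \/ 1 < #|LQ| \/ [set: G] = 1%g) :
  is_diam (component_of P LQ IQ)
    (\max_(i in IQ) \max_(l in LQ | P l i == None) zeta P l i).
Proof.
have upper a b : exists2 d, is_dist (component_of P LQ IQ) a b d & d <= max_zeta P LQ IQ.
  by apply: walk_le_dist; apply: component_walk_le.
split; first exact: upper.
have [a [b far]] := component_far_pair P_regular P_zero Q_closure.
have [d d_dist led] := upper a b; exists a, b.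
rewrite -/(max_zeta P LQ IQ); suff <- : d = max_zeta P LQ IQ by [].
have [[p [ap lp sp]] _] := d_dist.
by apply/eqP; rewrite eqn_leq led -sp far.
Qed.
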